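(* Let $(M^n,g)$ and $(F^m,h)$, $m\in\mathbb{N}$, be spin manifolds, let $f\in C^\infty(M)$, and consider the warped product $(M\times F,\ \bar g=g\oplus e^{-\frac{2f}{m}}h)$. Let $M$ be even-dimensional, let $\phi\in\Gamma(\Sigma M)$ be a spinor on $M$ and let $\nu\in\Gamma(\Sigma F)$ be a parallel spinor, i.e. $\nabla\nu=0$. Then the Dirac operator $\bar D$ on $\bar\Sigma(M\times F)\cong\Sigma M\otimes\Sigma F$ satisfies $$\bar D(\phi\otimes\nu)=(D_f\phi)\otimes\nu .$$
   Context: Clifford multiplication satisfies $v\cdot v=-|v|^2$. $\Sigma M,\Sigma F$ are the spinor bundles of $(M,g),(F,h)$ for fixed spin structures, with their spin connections $\nabla$ and Dirac operators $D\psi=\sum_ie_i\cdot\nabla_{e_i}\psi$ ($e_i$ a local orthonormal frame). The weighted Dirac operator on $\Sigma M$ is $D_f=D-\frac12\nabla f\cdot$, with $\nabla f$ the $g$-gradient acting by Clifford multiplication. $\bar\Sigma(M\times F)$ is the spinor bundle of $(M\times F,\bar g)$ for the induced (product) spin structure. Identification ($n=\dim M$ even): with $\pi_1,\pi_2$ the projections of $M\times F$ to $M,F$, one has $\bar\Sigma(M\times F)\cong\pi_1^*\Sigma M\otimes\pi_2^*\Sigma F$ as vector bundles (written $\Sigma M\otimes\Sigma F$, with pullbacks of sections suppressed), such that Clifford multiplication by $(x,v)\in TM\oplus TF=T(M\times F)$ with respect to $\bar g$ is $$(x,v)\cdot(\phi\otimes\nu)=(x\cdot\phi)\otimes\nu+\bar\phi\otimes(e^{-\frac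 fm}v\cdot\nu),$$ where on the right the Clifford multiplications are those of $\Sigma M$ and $\Sigma F$, and $\bar\phi=\phi^+-\phi^-$ is the conjugate spinor, $\phi=\phi^++\phi^-$ being the decomposition into $\pm1$-eigenvectors of $\omega_M=i^{\lfloor (n+1)/2\rfloor}e_1\cdots e_n$ ($e_1,\dots,e_n$ a positive orthonormal basis of $TM$). *)

(* Defs.v *)
From HB Require Import structures.
From mathcomp Require Import all_boot all_order all_algebra.
From mathcomp Require Import all_classical all_reals all_analysis.
From mathcomp Require Import complex mxtens.

Set Implicit Arguments.
Unset Strict Implicit.
Unset Printing Implicit Defensive.

Import Order.TTheory GRing.Theory Num.Theory numFieldNormedType.Exports.
Local Open Scope classical_set_scope.
Local Open Scope complex_scope.
Local Open Scope ring_scope.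

(** Every structure is a record of data (the names beginning with [pre], or a
    bare function) together with a predicate [is_...] carrying the axioms, so
    that the warped product can be defined as data.

    Matrices act on row vectors from the right: a tangent vector is a row, a
    frame is the matrix of its rows, and a linear map sends [v] to [v *m A]. *)

(* C^k on O: differentiable with C^(k-1) partial derivatives. *)
Fixpoint Ck_on (R : realType) (n k : nat) (O : set 'rV[R]_n)
    (u : 'rV[R]_n -> R) : Prop :=
  match k with
  | 0 => forall x, O x -> {for x, continuous u}
  | k'.+1 => (forall x, O x -> differentiable u x) /\
             forall l : 'I_n, Ck_on k' O (fun x => 'D_(delta_mx 0 l) u x)
  end.

Definition smooth_on (R : realType) (n : nat) (O : set 'rV[R]_n)
  (u : 'rV[R]_n -> R) : Prop := forall k, Ck_on k O u.

(* [chart_at] selects, at each point, the chart used to identify the tangent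
   space with R^n: a tangent vector at [p] *is* the row vector of its
   components in the chart [chart_at p].  The values of [chart] and [chart_inv]
   outside [chart_dom i] and its image are irrelevant. *)
Record premanifold (R : realType) (n : nat) := Premanifold {
  mpoint :> topologicalType;
  chart_ix : Type;
  chart_dom : chart_ix -> set mpoint;
  chart : chart_ix -> mpoint -> 'rV[R]_n;
  chart_inv : chart_ix -> 'rV[R]_n -> mpoint;
  chart_at : mpoint -> chart_ix }.

Definition is_manifold (R : realType) (n : nat) (M : premanifold R n) : Prop :=
  [/\ hausdorff_space M /\ @second_countable M,
      forall p : M, chart_dom (chart_at p) p,
      forall i : chart_ix M, open (chart_dom i) /\
                             open [set chart i p | p in chart_dom i],
      forall (i : chart_ix M) (p : M), chart_dom i p ->
        [/\ chart_inv i (chart i p) = p,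
            {for p, continuous (chart i)} &
            {for chart i p, continuous (chart_inv i)}] &
      forall (i j : chart_ix M) (l : 'I_n),
        smooth_on [set chart i p | p in chart_dom i `&` chart_dom j]
          (fun x => chart j (chart_inv i x) 0 l)].

Section Manifold.
Variables (R : realType) (n : nat) (M : premanifold R n).

Definition smooth_fun (U : set M) (u : M -> R) : Prop :=
  forall i : chart_ix M,
    smooth_on [set chart i p | p in chart_dom i `&` U] (u \o chart_inv i).

Definition dir_deriv (u : M -> R) (p : M) (v : 'rV[R]_n) : R :=
  'D_v (u \o chart_inv (chart_at p)) (chart (chart_at p) p).

(* If [v] lists the components of a tangent vector at [p] in the chart [i], then
   [v *m coord_change i j p] lists its components in the chart [j]. *)
Definition coord_change (i j : chart_ix M) (p : M) : 'M[R]_n :=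
  \matrix_(k, l)
    'D_(delta_mx 0 k) (fun x => chart j (chart_inv i x) 0 l) (chart i p).

(* Components in the chart [i], at the point with coordinates [x], of the [r]
   vector fields given by the rows of [E]. *)
Definition fields_in (r : nat) (i : chart_ix M) (E : M -> 'M[R]_(r, n))
    (x : 'rV[R]_n) : 'M[R]_(r, n) :=
  let p := chart_inv i x in E p *m coord_change (chart_at p) i p.

(* A (0,2)-tensor field: [g p] is the Gram matrix in the chart [chart_at p]. *)
Definition bilin := M -> 'M[R]_n.

Definition inner (g : bilin) (p : M) (v w : 'rV[R]_n) : R :=
  (v *m g p *m w^T) 0 0.

Definition metric_in (g : bilin) (i : chart_ix M) (x : 'rV[R]_n) : 'M[R]_n :=
  let p := chart_inv i x in
  let J := coord_change i (chart_at p) p in J *m g p *m J^T.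

Definition is_metric (g : bilin) : Prop :=
  [/\ forall p, (g p)^T = g p,
      forall p v, v != 0 -> 0 < inner g p v v &
      forall i k l, smooth_on [set chart i p | p in chart_dom i]
                      (fun x => metric_in g i x k l)].

Definition christoffel (g : bilin) (i : chart_ix M) (x : 'rV[R]_n)
    (a b k : 'I_n) : R :=
  let G := metric_in g i in
  let d (c s t : 'I_n) := 'D_(delta_mx 0 c) (fun y => G y s t) x in
  2^-1 * \sum_l invmx (G x) k l * (d a b l + d b a l - d l a b).

(* (nabla_v Y)(p), computed in the chart [chart_at p]. *)
Definition levi_civita (g : bilin) (Y : M -> 'rV[R]_n) (p : M)
    (v : 'rV[R]_n) : 'rV[R]_n :=
  let i := chart_at p in
  let x := chart i p in
  \row_k ('D_v (fun y => fields_in i Y y 0 k) x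
          + \sum_a \sum_b v 0 a * Y p 0 b * christoffel g i x a b k).

Definition gradient (g : bilin) (f : M -> R) (p : M) : 'rV[R]_n :=
  (\row_k dir_deriv f p (delta_mx 0 k)) *m invmx (g p).

End Manifold.

Section Clifford.
Variables (R : realType) (n N : nat) (gam : 'I_n -> 'M[R[i]]_N).

(* A complex module over the Clifford algebra with v v = - |v|^2.  The dimension
   2^(floor (n/2)) is that of the irreducible ones, so this is the spinor module
   (for n odd, either of the two inequivalent ones). *)
Definition is_spinor_module : Prop :=
  N = (2 ^ n./2)%N /\
  forall k l, gam k *m gam l + gam l *m gam k = (- (k == l)%:R *+ 2)%:M.

Definition cliff (v : 'rV[R]_n) : 'M[R[i]]_N := \sum_k (v 0 k)%:C *: gam k.

(* omega = i^(floor ((n+1)/2)) e_1 ... e_n.  For n even omega^2 = 1, and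
   multiplication by omega is the conjugation phi^+ + phi^- |-> phi^+ - phi^-. *)
Definition omega : 'M[R[i]]_N :=
  (0 +i* 1) ^+ (n.+1./2) *: \big[mulmx/1%:M]_(k < n) gam k.

(* Spin(n), as products of evenly many unit vectors, in its (faithful) complex
   spin representation. *)
Definition spin_group : set 'M[R[i]]_N :=
  [set s | exists vs : seq 'rV[R]_n,
     [/\ ~~ odd (size vs),
         forall v, v \in vs -> (v *m v^T) 0 0 = 1 &
         s = foldr (fun v t => cliff v *m t) 1%:M vs]].

End Clifford.

(* A spin structure presented by local trivializations: an open cover, over each
   patch a positive orthonormal frame, and on overlaps a lift to Spin(n) of the
   transition functions of the frames. *)
Record prespin (R : realType) (n : nat) (M : premanifold R n) := Prespin {
  spin_rank : nat;
  spin_gamma : 'I_n -> 'M[R[i]]_spin_rank;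
  spin_ix : Type;
  spin_dom : spin_ix -> set M;
  spin_frame : spin_ix -> M -> 'M[R]_n;
  spin_lift : spin_ix -> spin_ix -> M -> 'M[R[i]]_spin_rank }.

Section Spin.
Variables (R : realType) (n : nat) (M : premanifold R n) (g : bilin M).
Variable S : prespin M.

(* The orientation of M is the one given by the frames.  If e, e' are the frames
   of the patches a, b and e'_k = sum_l A_lk e_l, then s = [spin_lift a b] lies over
   A, that is, s gamma_k s^-1 = sum_l A_lk gamma_l. *)
Definition is_spin_structure : Prop :=
  is_spinor_module (spin_gamma S) /\
  [/\ forall a : spin_ix S, open (spin_dom a),
      forall p : M, exists a : spin_ix S, spin_dom a p,
      forall (a b : spin_ix S) p, spin_dom a p -> spin_dom b p ->
        spin_frame a p *m g p *m (spin_frame a p)^T = 1%:M /\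
        \det (spin_frame a p *m g p *m (spin_frame b p)^T) = 1 &
      forall (a : spin_ix S) i k l,
        smooth_on [set chart i p | p in chart_dom i `&` spin_dom a]
          (fun x => fields_in i (spin_frame a) x k l)] /\
  [/\ forall (a b : spin_ix S) p, spin_dom a p -> spin_dom b p ->
        spin_group (spin_gamma S) (spin_lift a b p),
      forall (a b : spin_ix S) r s,
        smooth_fun (spin_dom a `&` spin_dom b) (fun p => complex.Re (spin_lift a b p r s)) /\
        smooth_fun (spin_dom a `&` spin_dom b) (fun p => complex.Im (spin_lift a b p r s)),
      forall (a b : spin_ix S) p k, spin_dom a p -> spin_dom b p ->
        spin_lift a b p *m spin_gamma S k =
        (\sum_l (inner g p (row l (spin_frame a p)) (row k (spin_frame b p)))%:C
                  *: spin_gamma S l) *m spin_lift a b p &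
      forall (a b c : spin_ix S) p, spin_dom a p -> spin_dom b p -> spin_dom c p ->
        spin_lift a b p *m spin_lift b c p = spin_lift a c p].

(* Sections of the spinor bundle, in local trivializations; the value of
   [psi a p] is irrelevant unless [spin_dom a p]. *)
Definition prespinor := spin_ix S -> M -> 'cV[R[i]]_(spin_rank S).

Definition is_spinor (psi : prespinor) : Prop :=
  (forall (a b : spin_ix S) p, spin_dom a p -> spin_dom b p ->
     psi a p = spin_lift a b p *m psi b p) /\
  (forall (a : spin_ix S) r,
     smooth_fun (spin_dom a) (fun p => complex.Re (psi a p r 0)) /\
     smooth_fun (spin_dom a) (fun p => complex.Im (psi a p r 0))).

(* Clifford multiplication at [p], in the trivialization [a]. *)
Definition cliff_mul (a : spin_ix S) (p : M) (v : 'rV[R]_n)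
    (z : 'cV[R[i]]_(spin_rank S)) : 'cV[R[i]]_(spin_rank S) :=
  cliff (spin_gamma S) (\row_k inner g p v (row k (spin_frame a p))) *m z.

Definition spinor_dir_deriv (psi : M -> 'cV[R[i]]_(spin_rank S)) (p : M)
    (v : 'rV[R]_n) : 'cV[R[i]]_(spin_rank S) :=
  \col_r (dir_deriv (fun q => complex.Re (psi q r 0)) p v
          +i* dir_deriv (fun q => complex.Im (psi q r 0)) p v).

(* The connection induced by Levi-Civita: in the frame e of the patch [a],
   nabla_v psi = d psi (v) + 1/2 sum_(k<l) <nabla_v e_k, e_l> e_k e_l psi. *)
Definition spin_connection (psi : prespinor) (a : spin_ix S) (p : M)
    (v : 'rV[R]_n) : 'cV[R[i]]_(spin_rank S) :=
  let e (k : 'I_n) (q : M) := row k (spin_frame a q) in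
  spinor_dir_deriv (psi a) p v +
  2^-1 *: \sum_(k < n) \sum_(l < n | (k < l)%N)
    (inner g p (levi_civita g (e k) p v) (e l p))%:C *:
      (spin_gamma S k *m spin_gamma S l *m psi a p).

Definition parallel (psi : prespinor) : Prop :=
  forall a p v, spin_dom a p -> spin_connection psi a p v = 0.

Definition dirac_op (psi : prespinor) : prespinor :=
  fun a p => \sum_k cliff_mul a p (row k (spin_frame a p))
                      (spin_connection psi a p (row k (spin_frame a p))).

Definition weighted_dirac (f : M -> R) (psi : prespinor) : prespinor :=
  fun a p => dirac_op psi a p - 2^-1 *: cliff_mul a p (gradient g f p) (psi a p).

End Spin.

Section Product.
Variables (R : realType) (n m : nat).
Variables (M : premanifold R n) (F : premanifold R m).

Definition product_manifold : premanifold R (n + m) :=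
  @Premanifold R (n + m) (M * F)%type (chart_ix M * chart_ix F)%type
    (fun ij => chart_dom ij.1 `*` chart_dom ij.2)
    (fun ij pq => row_mx (chart ij.1 pq.1) (chart ij.2 pq.2))
    (fun ij x => (chart_inv ij.1 (lsubmx x), chart_inv ij.2 (rsubmx x)))
    (fun pq => (chart_at pq.1, chart_at pq.2)).

(* The tangent vector (x, v) of the product is [row_mx x v]. *)
Definition warped_metric (f : M -> R) (g : bilin M) (h : bilin F) :
    bilin product_manifold :=
  fun pq => block_mx (g pq.1) 0
              0 (expR (- (2 * f pq.1 / m%:R)) *: h pq.2).

(* [tensmx] is the Kronecker product. *)
Definition product_gamma (N N' : nat) (gam : 'I_n -> 'M[R[i]]_N)
    (gam' : 'I_m -> 'M[R[i]]_N') (k : 'I_(n + m)) : 'M[R[i]]_(N * N') :=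
  match fintype.split k with
  | inl k1 => tensmx (gam k1) 1%:M
  | inr k2 => tensmx (omega gam) (gam' k2)
  end.

(* The product spin structure of the warped metric (n even).  The frame of a
   pair of patches is (e_k, 0), (0, exp (f/m) e'_l).  For s in Spin(n), s' in
   Spin(m), the element s s' of Spin(n + m) acts through [product_gamma] as
   [tensmx s s'], even elements commuting with [omega]; the resulting spinor
   bundle is therefore the tensor product of the two spinor bundles. *)
Definition warped_spin (f : M -> R) (SM : prespin M) (SF : prespin F) :
    prespin product_manifold :=
  @Prespin R (n + m) product_manifold (spin_rank SM * spin_rank SF)
    (product_gamma (spin_gamma SM) (spin_gamma SF))
    (spin_ix SM * spin_ix SF)%type
    (fun ab => spin_dom ab.1 `*` spin_dom ab.2)
    (fun ab pq => block_mx (spin_frame ab.1 pq.1) 0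
                    0 (expR (f pq.1 / m%:R) *: spin_frame ab.2 pq.2))
    (fun ab cd pq => tensmx (spin_lift ab.1 cd.1 pq.1) (spin_lift ab.2 cd.2 pq.2)).

Definition tensor_spinor (f : M -> R) (SM : prespin M) (SF : prespin F)
    (phi : prespinor SM) (nu : prespinor SF) : prespinor (warped_spin f SM SF) :=
  fun ab pq => tensmx (phi ab.1 pq.1) (nu ab.2 pq.2).

(* The description of Clifford multiplication on the tensor product of the two
   spinor bundles: (x, v)(z (x) w) = (x z) (x) w + conj z (x) exp(-f/m) (v w). *)
Lemma warped_cliff_mul (f : M -> R) (g : bilin M) (h : bilin F)
    (SM : prespin M) (SF : prespin F) (a : spin_ix SM) (b : spin_ix SF)
    (p : M) (q : F) (x : 'rV[R]_n) (v : 'rV[R]_m)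
    (z : 'cV[R[i]]_(spin_rank SM)) (w : 'cV[R[i]]_(spin_rank SF)) :
  @cliff_mul _ _ _ (warped_metric f g h) (warped_spin f SM SF) (a, b) (p, q)
    (row_mx x v) (tensmx z w) =
  tensmx (cliff_mul g a p x z) w +
  tensmx (omega (@spin_gamma _ _ _ SM) *m z)
    ((expR (- (f p / m%:R)))%:C *: cliff_mul h b q v w).
Proof.
have tZl k1 k2 k3 k4 (c : R[i]) (A : 'M[R[i]]_(k1, k2)) (B : 'M[R[i]]_(k3, k4)) :
  tensmx (c *: A) B = c *: tensmx A B.
  by apply/matrixP => i j; rewrite !mxE mulrA.
have tZr k1 k2 k3 k4 (c : R[i]) (A : 'M[R[i]]_(k1, k2)) (B : 'M[R[i]]_(k3, k4)) :
  tensmx A (c *: B) = c *: tensmx A B.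
  by apply/matrixP => i j; rewrite !mxE mulrCA.
have tSl k1 k2 k3 k4 (I : finType) (A : I -> 'M[R[i]]_(k1, k2))
    (B : 'M[R[i]]_(k3, k4)) : tensmx (\sum_i A i) B = \sum_i tensmx (A i) B.
  apply/matrixP => i j; rewrite !mxE !summxE mulr_suml.
  by apply: eq_bigr => k _; rewrite !mxE.
have tSr k1 k2 k3 k4 (I : finType) (A : 'M[R[i]]_(k1, k2))
    (B : I -> 'M[R[i]]_(k3, k4)) : tensmx A (\sum_i B i) = \sum_i tensmx A (B i).
  apply/matrixP => i j; rewrite !mxE !summxE mulr_sumr.
  by apply: eq_bigr => k _; rewrite !mxE.
have tM (A : 'M[R[i]]_(spin_rank SM)) (B : 'M[R[i]]_(spin_rank SF)) :
    tensmx A B *m (tensmx z w : 'cV_(spin_rank SM * spin_rank SF)) =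
    tensmx (A *m z) (B *m w) :> 'cV_(spin_rank SM * spin_rank SF).
  exact: (@tensmx_mul R[i] _ _ _ _ 1%N 1%N A B z w).
have innerE (X Y : 'rV[R]_n) (V W : 'rV[R]_m) :
    @inner _ _ product_manifold (warped_metric f g h) (p, q)
      (row_mx X V) (row_mx Y W) =
    inner g p X Y + expR (- (2 * f p / m%:R)) * inner h q V W.
  rewrite /inner /warped_metric /= tr_row_mx mul_row_block !mulmx0 addr0 add0r.
  by rewrite mul_row_col [LHS]mxE -scalemxAr -scalemxAl [X in _ + X]mxE.
have rowl (k : 'I_n) :
    row (lshift m k) (@spin_frame _ _ _ (warped_spin f SM SF) (a, b) (p, q))
    = row_mx (row k (spin_frame a p)) 0.
  rewrite -[RHS]/(row_mx _ _) /= /block_mx; apply/rowP => j.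
  rewrite [LHS]mxE col_mxEu.
  by rewrite !mxE; case: fintype.splitP => ? ?; rewrite !mxE.
have rowr (l : 'I_m) :
    row (rshift n l) (@spin_frame _ _ _ (warped_spin f SM SF) (a, b) (p, q))
    = row_mx 0 (expR (f p / m%:R) *: row l (spin_frame b q)).
  rewrite /= /block_mx; apply/rowP => j; rewrite [LHS]mxE col_mxEd.
  by rewrite !mxE; case: fintype.splitP => ? ?; rewrite !mxE.
have inn0 (v' : 'rV[R]_m) : inner h q v' 0 = 0 by rewrite /inner trmx0 mulmx0 mxE.
have inn0' (v' : 'rV[R]_n) : inner g p v' 0 = 0 by rewrite /inner trmx0 mulmx0 mxE.
have innZ c (v' w' : 'rV[R]_m) : inner h q v' (c *: w') = c * inner h q v' w'.
  by rewrite /inner linearZ /= -scalemxAr mxE.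
rewrite /cliff_mul /cliff big_split_ord /= mulmxDl; congr (_ + _).
  rewrite !mulmx_suml tSl; apply: eq_bigr => k _.
  rewrite !mxE rowl innerE inn0 mulr0 addr0 /product_gamma (unsplitK (inl k)).
  by rewrite -!scalemxAl tM mul1mx tZl.
rewrite tZr !mulmx_suml tSr scaler_sumr; apply: eq_bigr => k _.
rewrite !mxE rowr innerE inn0' add0r innZ /product_gamma (unsplitK (inr k)).
rewrite -!scalemxAl tM tZr scalerA; congr (_ *: _); last by rewrite scalemxAl.
rewrite mulrA -expRD -rmorphM /=; congr ((expR _ * _)%:C).
by rewrite -mulrA mulr_natl mulr2n opprD addrNK.
Qed.


End Product.

Arguments tensor_spinor {R n m M F} f {SM SF}.

(* Main.v *)
Require Import Defs.
From HB Require Import structures.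
From mathcomp Require Import all_boot all_order all_algebra.
From mathcomp Require Import all_classical all_reals all_analysis.
From mathcomp Require Import complex mxtens.
From mathcomp Require Import ring.

(** In the orthonormal frame (e_k, 0), (0, exp (f/m) e'_l) of the warped metric
    the Koszul formula gives the connection coefficients.  Along (x, 0) they are
    those of M, so the derivative of phi (x) nu is (nabla_x phi) (x) nu.  Along
    (0, v) they are those of F together with the mixed terms
    - exp (-f/m) / m * df(e_k) h(v, e'_l); since nu is parallel, only the mixed
    terms survive.  As omega anticommutes with every e_k and omega^2 = 1 (n even),
    the m vertical directions contribute - 1/(2m) grad f . phi (x) nu each, which
    adds up to the weight term of D_f. *)

(** * Directional derivatives of functions on row vectors *)

Section Analysis.
Set Implicit Arguments.
Unset Strict Implicit.
Import Order.TTheory GRing.Theory Num.Theory numFieldNormedType.Exports.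
Local Open Scope classical_set_scope.
Local Open Scope ring_scope.
Variable R : realType.

(* Only the difference quotients are compared, so nothing has to be
   differentiable. *)
Lemma derive_line (U V W : normedModType R) (u : U -> W) (w : V -> W)
    (a v : U) (b t : V) :
  (forall s : R, u (s *: v + a) = w (s *: t + b)) -> 'D_v u a = 'D_t w b.
Proof.
move=> uw; rewrite /derive.
have uab : u a = w b by have := uw 0; rewrite !scale0r !add0r.
have -> // : (fun s : R => s^-1 *: ((u \o shift a) (s *: v) - u a)) =
             (fun s : R => s^-1 *: ((w \o shift b) (s *: t) - w b)).
by apply/funext => s /=; rewrite uw uab.
Qed.

Lemma derive_sumE n (u : 'rV[R]_n -> R) (x v : 'rV[R]_n) :
  differentiable u x -> 'D_v u x = \sum_k v 0 k * 'D_(delta_mx 0 k) u x.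
Proof.
move=> du; rewrite deriveE// [in LHS](row_sum_delta v) linear_sum.
by apply: eq_bigr => k _; rewrite linearZ /= deriveE.
Qed.

Lemma differentiable_expRM (V : normedModType R) (u : V -> R) (k : R) (x : V) :
  differentiable u x -> differentiable (fun y => expR (k * u y)) x.
Proof.
move=> du; apply: (differentiable_comp (f := k \*: u) (g := expR)).
  exact: differentiableZ.
by apply/derivable1_diffP.
Qed.

Lemma derive_expRM (V : normedModType R) (u : V -> R) (k : R) (x v : V) :
  differentiable u x ->
  'D_v (fun y => expR (k * u y)) x = k * expR (k * u x) * 'D_v u x.
Proof.
move=> du.
have dk : differentiable (fun y => k * u y) x.
  exact: (differentiableZ k du).
have de : differentiable (expR : R -> R) (k * u x).
  by apply/derivable1_diffP.
rewrite deriveE; last exact: (differentiable_comp dk de).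
rewrite (diff_comp dk de) /= diff1E// derive1E
  (@derive_val _ _ _ _ _ _ _ (is_derive_expR _)).
rewrite -deriveE// (deriveZ k (diff_derivable _))//.
by rewrite /GRing.scale /= mulrAC.
Qed.

Lemma derive_mulr (V : normedModType R) (u : V -> R) (c : R) (x v : V) :
  differentiable u x -> 'D_v (fun y => u y * c) x = 'D_v u x * c.
Proof.
move=> du; transitivity ('D_v (c \*: u) x).
  by congr ('D_v _ x); apply/funext => y /=; rewrite mulrC.
by rewrite (deriveZ c (diff_derivable _))// mulrC.
Qed.

(** This is the shape of the real and of the imaginary part of a complex product in which one factor
    is constant. *)
Lemma derive_mulrD (V : normedModType R) (u w : V -> R) (c d : R) (x v : V) :
  differentiable u x -> differentiable w x ->
  'D_v (fun y => u y * c + w y * d) x = 'D_v u x * c + 'D_v w x * d.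
Proof.
move=> du dw.
have dM (t : V -> R) e : differentiable t x -> differentiable (fun y => t y * e) x.
  move=> dt; have -> : (fun y => t y * e) = e \*: t.
    by apply/funext => y /=; rewrite mulrC.
  exact: differentiableZ.
rewrite -!derive_mulr//; apply: deriveD; exact/diff_derivable/dM.
Qed.

Lemma smooth_on_differentiable n (O : set 'rV[R]_n) (u : 'rV[R]_n -> R) x :
  smooth_on O u -> O x -> differentiable u x.
Proof. by move=> /(_ 1%N) [+ _]; apply. Qed.

End Analysis.

(** * Coordinates, the Levi-Civita connection and the gradient at a point *)

Section Geometry.
Set Implicit Arguments.
Unset Strict Implicit.
Import Order.TTheory GRing.Theory Num.Theory numFieldNormedType.Exports.
Local Open Scope classical_set_scope.
Local Open Scope ring_scope.
Variables (R : realType) (n : nat) (M : premanifold R n).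

Lemma bilinE r s (u : 'rV[R]_r) (A : 'M[R]_(r, s)) (w : 'rV[R]_s) :
  (u *m A *m w^T) 0 0 = \sum_a \sum_b u 0 a * A a b * w 0 b.
Proof.
rewrite mxE exchange_big /=; apply: eq_bigr => b _.
by rewrite !mxE mulr_suml.
Qed.

Lemma innerDl (g : bilin M) (p : M) u v w :
  inner g p (u + v) w = inner g p u w + inner g p v w.
Proof. by rewrite /inner !mulmxDl mxE. Qed.

Lemma coord_change_id (i : chart_ix M) (p : M) :
  is_manifold M -> chart_dom i p -> coord_change i i p = 1%:M.
Proof.
move=> [_ _ Mopen Minv _] ip; apply/matrixP => k l; rewrite !mxE.
transitivity ('D_(delta_mx 0 k) (fun x : 'rV[R]_n => x 0 l) (chart i p)).
  (* [chart i] after [chart_inv i] is the identity only on the image of the chart; that image is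
     open, so the derivative at a point of it is that of a coordinate function. *)
  apply: near_eq_derive; have [_ Oi] := Mopen i.
  have /Oi : [set chart i q | q in chart_dom i] (chart i p) by exists p.
  by apply: filterS => _ [q iq <-]; have [-> _ _] := Minv i q iq.
(* Along [delta_mx 0 k] the coordinate [l] moves on the real line with speed [k == l]. *)
rewrite (@derive_line _ _ _ _ _ (@id R) _ _ (chart i p 0 l) ((k == l)%:R)).
  by rewrite derive_id.
by move=> s; rewrite !mxE eqxx eq_sym.
Qed.

Lemma coord_change_at (p : M) : is_manifold M ->
  coord_change (chart_at p) (chart_at p) p = 1%:M.
Proof. by move=> Mm; case: (Mm) => _ dom _ _ _; rewrite coord_change_id. Qed.

Lemma chart_atK (p : M) : is_manifold M ->
  chart_inv (chart_at p) (chart (chart_at p) p) = p.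
Proof. by case=> _ dom _ inv _; have [] := inv _ _ (dom p). Qed.

Lemma metric_in_at (g : bilin M) (p : M) : is_manifold M ->
  metric_in g (chart_at p) (chart (chart_at p) p) = g p.
Proof.
by move=> Mm; rewrite /metric_in chart_atK// coord_change_at// mul1mx trmx1 mulmx1.
Qed.

Lemma fields_in_at r (E : M -> 'M[R]_(r, n)) (p : M) : is_manifold M ->
  fields_in (chart_at p) E (chart (chart_at p) p) = E p.
Proof. by move=> Mm; rewrite /fields_in chart_atK// coord_change_at// mulmx1. Qed.

(** A nonzero row in the kernel of [g p] would have length zero, against positivity. *)
Lemma metric_unitmx (g : bilin M) (p : M) : is_metric g -> g p \in unitmx.
Proof.
move=> [_ gpos _]; rewrite -row_free_unit -kermx_eq0.
apply/eqP/row_matrixP => i; rewrite row0; apply/eqP/negP => /negP /(gpos p).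
by rewrite /inner (sub_kermxP (row_sub i (kermx (g p)))) mul0mx mxE ltxx.
Qed.

Lemma smooth_fun_differentiable (u : M -> R) (U : set M) (p : M) :
  is_manifold M -> smooth_fun U u -> U p ->
  differentiable (u \o chart_inv (chart_at p)) (chart (chart_at p) p).
Proof.
move=> [_ dom _ _ _] us Up; apply: (smooth_on_differentiable (us _)).
by exists p; split => //; exact: dom.
Qed.

(** Gram matrices at different points refer to different charts, so the derivative is that of
    [metric_in] in the single chart [chart_at p]. *)
Definition partial_metric (g : bilin M) (p : M) (a : 'I_n) : 'M[R]_n :=
  \matrix_(s, t) 'D_(delta_mx 0 a) (fun y => metric_in g (chart_at p) y s t)
                   (chart (chart_at p) p).

(** A combination of partial derivatives rather than a derivative along [v], so that linearity in
    [v] holds by construction. *)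
Definition metric_deriv (g : bilin M) (p : M) (v : 'rV[R]_n) : 'M[R]_n :=
  \sum_a v 0 a *: partial_metric g p a.

Lemma metric_deriv_bilinE (g : bilin M) p (v u w : 'rV[R]_n) :
  (u *m metric_deriv g p v *m w^T) 0 0 =
  \sum_a \sum_b \sum_c v 0 a * u 0 b * w 0 c * partial_metric g p a b c.
Proof.
rewrite /metric_deriv mulmx_sumr mulmx_suml summxE; apply: eq_bigr => a _.
rewrite -scalemxAr -scalemxAl mxE bilinE mulr_sumr; apply: eq_bigr => b _.
rewrite mulr_sumr; apply: eq_bigr => c _; ring.
Qed.

(* The Christoffel symbols of the first kind, contracted with v, Y and Z. *)
Definition koszul (g : bilin M) (p : M) (v Y Z : 'rV[R]_n) : R :=
  2^-1 * ((Y *m metric_deriv g p v *m Z^T) 0 0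
          + (v *m metric_deriv g p Y *m Z^T) 0 0
          - (v *m metric_deriv g p Z *m Y^T) 0 0).

(** The part of [levi_civita] that does not involve Christoffel symbols. *)
Definition field_deriv (Y : M -> 'rV[R]_n) (p : M) (v : 'rV[R]_n) : 'rV[R]_n :=
  \row_k 'D_v (fun y => fields_in (chart_at p) Y y 0 k) (chart (chart_at p) p).

(** The inverse Gram matrix inside the Christoffel symbols cancels against the Gram matrix of the
    inner product. The hypotheses concern the one point [p], so for the warped metric they are
    checked by a block computation. *)
Lemma inner_levi_civita (g : bilin M) (Y : M -> 'rV[R]_n) (p : M) (v Z : 'rV[R]_n) :
  metric_in g (chart_at p) (chart (chart_at p) p) = g p ->
  (g p)^T = g p -> g p \in unitmx ->
  inner g p (levi_civita g Y p v) Z =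
  inner g p (field_deriv Y p v) Z + koszul g p v (Y p) Z.
Proof.
move=> gat gsym gunit.
(* [d] is kept opaque so that [mxE] stops at its entries instead of unfolding the partial
   derivatives. *)
have [d dP] : exists d, d = partial_metric g p by exists (partial_metric g p).
have dE a s t : d a s t = 'D_(delta_mx 0 a)
    (fun y => metric_in g (chart_at p) y s t) (chart (chart_at p) p).
  by rewrite dP mxE.
(* Twice the Christoffel symbols of the first kind, as a row in the last index. *)
pose c a b : 'rV[R]_n := \row_l (d a b l + d b a l - d l a b).
have -> : levi_civita g Y p v = field_deriv Y p v +
    (2^-1 *: \sum_a \sum_b (v 0 a * Y p 0 b) *: c a b) *m invmx (g p).
  apply/rowP => k; rewrite mxE [RHS]mxE [X in _ = X + _]mxE; congr (_ + _).
  rewrite -scalemxAl mxE mulmx_suml summxE mulr_sumr; apply: eq_bigr => a _.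
  rewrite mulmx_suml summxE mulr_sumr; apply: eq_bigr => b _.
  rewrite -scalemxAl mxE mulrCA; congr (_ * _).
  rewrite /christoffel gat; congr (_ * _); rewrite mxE; apply: eq_bigr => l _.
  rewrite [RHS]mulrC -[in LHS]gsym -trmx_inv mxE; congr (_ * _).
  by rewrite [RHS]mxE; congr (_ + _ - _); rewrite dE.
rewrite innerDl; congr (_ + _).
rewrite /inner mulmxKV// /koszul -scalemxAl mxE; congr (_ * _).
rewrite !metric_deriv_bilinE -dP mulmx_suml summxE.
(* All three terms are brought to the same order of summation: the index of [v], then that of [Y p],
   then that of [Z]. *)
rewrite [X in _ + X - _]exchange_big /= -big_split /=.
rewrite [X in _ - X](_ : _ = \sum_a \sum_b \sum_c0
  v 0 a * Y p 0 b * Z 0 c0 * d c0 a b); last first.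
  rewrite exchange_big /=; apply: eq_bigr => a _.
  rewrite exchange_big /=; apply: eq_bigr => b _; apply: eq_bigr => l _; ring.
rewrite -sumrB; apply: eq_bigr => a _.
rewrite -big_split -sumrB mulmx_suml summxE; apply: eq_bigr => b _ /=.
rewrite -big_split -sumrB -scalemxAl mxE mxE mulr_sumr; apply: eq_bigr => l _ /=.
rewrite !mxE; ring.
Qed.

Lemma inner_gradient (g : bilin M) (f : M -> R) (p : M) (v : 'rV[R]_n) :
  is_manifold M -> is_metric g -> smooth_fun setT f ->
  inner g p (gradient g f p) v = dir_deriv f p v.
Proof.
move=> Mm gm fs; rewrite /inner /gradient mulmxKV ?metric_unitmx// mxE.
rewrite /dir_deriv derive_sumE; last exact: (smooth_fun_differentiable Mm fs).
by apply: eq_bigr => k _; rewrite !mxE mulrC.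
Qed.

End Geometry.

(** * Clifford relations and the volume element [omega] *)

Section CliffordAlgebra.
Set Implicit Arguments.
Unset Strict Implicit.
Import Order.TTheory GRing.Theory Num.Theory.
Local Open Scope complex_scope.
Local Open Scope ring_scope.
Variables (R : realType) (n N : nat) (gam : 'I_n -> 'M[R[i]]_N).
Hypothesis gamP : is_spinor_module gam.

Lemma gamma_sqr k : gam k *m gam k = - 1%:M.
Proof.
have [_ /(_ k k)] := gamP; rewrite eqxx => e.
apply: (@scalerI R[i] _ 2); first by rewrite pnatr_eq0.
by rewrite scaler_nat mulr2n e mulNrn raddfN scalerN scaler_nat raddfMn.
Qed.

Lemma gamma_anticomm k l : k != l -> gam k *m gam l = - (gam l *m gam k).
Proof.
move=> kl; have [_ /(_ k l)] := gamP.
by rewrite (negPf kl) oppr0 mul0rn raddf0 => /eqP; rewrite addr_eq0 => /eqP.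
Qed.

(** Passing [gam j] through the product costs a sign for each factor other than [gam j] itself. That
    number of factors is [size s - (j \in s)], which has the parity of the exponent. *)
Lemma gamma_prod_comm j (s : seq 'I_n) : uniq s ->
  gam j *m \big[mulmx/1%:M]_(k <- s) gam k =
  (-1) ^+ (size s + (j \in s)) *: (\big[mulmx/1%:M]_(k <- s) gam k *m gam j).
Proof.
elim: s => [|k s IH] /=; first by rewrite !big_nil mul1mx mulmx1 scale1r.
case/andP => ks /IH{}IH; rewrite !big_cons inE.
case: (eqVneq j k) => [jk|jk] /=.
  rewrite jk in IH *; rewrite -mulmxA {1}IH (negPf ks) addn0 -scalemxAr mulmxA.
  by rewrite addn1 2!exprS !mulN1r opprK.
rewrite mulmxA (gamma_anticomm jk) mulNmx -[in LHS]mulmxA IH.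
by rewrite -scalemxAr mulmxA addSn exprS mulN1r scaleNr.
Qed.

(** With r factors, reordering costs r(r-1)/2 signs and the r squares cost one sign each, r(r+1)/2
    in all. *)
Lemma gamma_prod_sqr (s : seq 'I_n) : uniq s ->
  \big[mulmx/1%:M]_(k <- s) gam k *m \big[mulmx/1%:M]_(k <- s) gam k =
  (-1) ^+ 'C((size s).+1, 2) *: 1%:M.
Proof.
elim: s => [|k s IH] /=.
  by rewrite !big_nil mul1mx bin_small// expr0 scale1r.
case/andP => ks us; rewrite big_cons -mulmxA.
rewrite [X in _ *m X]mulmxA.
set P := \big[mulmx/1%:M]_(k <- s) gam k in IH *.
have -> : P *m gam k = (-1) ^+ size s *: (gam k *m P).
  rewrite gamma_prod_comm// (negPf ks) addn0 scalerA -exprD addnn.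
  by rewrite -signr_odd odd_double scale1r.
rewrite -scalemxAl -scalemxAr -[gam k *m P *m P]mulmxA IH//.
rewrite mulmxA gamma_sqr mulNmx mul1mx scalerN scalerA -scaleNr -mulN1r mulrA.
by rewrite -exprS -exprD [in RHS]binS bin1 addnC.
Qed.

Hypothesis n_even : ~~ odd n.

(** For n even the squared power of i is (-1)^(n/2), and the product of the generators has square
    (-1)^(n(n+1)/2). The two signs agree because n+1 is odd. *)
Lemma omega_sqr : omega gam *m omega gam = 1%:M.
Proof.
rewrite /omega -scalemxAl -scalemxAr gamma_prod_sqr ?index_enum_uniq//.
rewrite !scalerA -expr2 exprAC.
have -> : (0 +i* 1 : R[i]) ^+ 2 = -1 by exact: sqr_i.
rewrite -exprD [size _](_ : _ = n); last first.
  by rewrite -[RHS](size_enum_ord n) enumT /index_enum unlock.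
rewrite -signr_odd oddD bin2 -uphalfE uphalf_half (negPf n_even) /=.
suff -> : odd ((n.+1 * n)./2) = odd n./2 by rewrite add0n addbb scale1r.
rewrite -[n in LHS]odd_double_half (negPf n_even) add0n -muln2 mulnA muln2 doubleK.
by rewrite oddM /= muln2 odd_double.
Qed.

(** All n generators occur in [omega], so the sign has exponent n+1, which is odd. *)
Lemma gamma_omega k : gam k *m omega gam = - (omega gam *m gam k).
Proof.
rewrite /omega -scalemxAr gamma_prod_comm ?index_enum_uniq// mem_index_enum.
rewrite [size _](_ : _ = n); last first.
  by rewrite -[RHS](size_enum_ord n) enumT /index_enum unlock.
rewrite -signr_odd oddD (negPf n_even) scaleN1r scalerN.
by rewrite -scalemxAl.
Qed.

End CliffordAlgebra.

(** * Bilinearity of the Kronecker product *)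

Section Tensor.
Set Implicit Arguments.
Unset Strict Implicit.
Import Order.TTheory GRing.Theory Num.Theory.
Local Open Scope ring_scope.
Variable R : comNzRingType.
Variables k1 k2 k3 k4 : nat.
Implicit Types (A : 'M[R]_(k1, k2)) (B : 'M[R]_(k3, k4)).

Lemma tensmxZl c A B : tensmx (c *: A) B = c *: tensmx A B.
Proof. by apply/matrixP => i j; rewrite !mxE mulrA. Qed.

Lemma tensmxZr c A B : tensmx A (c *: B) = c *: tensmx A B.
Proof. by apply/matrixP => i j; rewrite !mxE mulrCA. Qed.

Lemma tensmxDl A A' B : tensmx (A + A') B = tensmx A B + tensmx A' B.
Proof. by apply/matrixP => i j; rewrite !mxE mulrDl. Qed.

Lemma tensmxDr A B B' : tensmx A (B + B') = tensmx A B + tensmx A B'.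
Proof. by apply/matrixP => i j; rewrite !mxE mulrDr. Qed.

Lemma tensmx_suml (I : finType) (P : pred I) (A : I -> 'M[R]_(k1, k2)) B :
  tensmx (\sum_(i | P i) A i) B = \sum_(i | P i) tensmx (A i) B.
Proof.
apply/matrixP => i j; rewrite !mxE !summxE mulr_suml.
by apply: eq_bigr => k _; rewrite !mxE.
Qed.

Lemma tensmx_sumr (I : finType) (P : pred I) A (B : I -> 'M[R]_(k3, k4)) :
  tensmx A (\sum_(i | P i) B i) = \sum_(i | P i) tensmx A (B i).
Proof.
apply/matrixP => i j; rewrite !mxE !summxE mulr_sumr.
by apply: eq_bigr => k _; rewrite !mxE.
Qed.

Lemma tensmxNl A B : tensmx (- A) B = - tensmx A B.
Proof. by rewrite -scaleN1r tensmxZl scaleN1r. Qed.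

Lemma tensmxNr A B : tensmx A (- B) = - tensmx A B.
Proof. by rewrite -scaleN1r tensmxZr scaleN1r. Qed.

End Tensor.

(** A Kronecker product of columns has [1 * 1] columns, which computes to 1; the type annotations
    make both sides columns. *)
Lemma tensmx_mul_col (R : comNzRingType) (k1 k2 k3 k4 : nat)
    (A : 'M[R]_(k1, k2)) (B : 'M[R]_(k3, k4)) (z : 'cV[R]_k2) (w : 'cV[R]_k4) :
  (tensmx A B *m (tensmx z w : 'cV_(k2 * k4)) =
   tensmx (A *m z) (B *m w) :> 'cV_(k1 * k3))%R.
Proof. exact: (@tensmx_mul R _ _ _ _ 1 1 A B z w). Qed.

(** * Coordinates and the Koszul formula on the warped product *)

Section WarpedGeometry.
Set Implicit Arguments.
Unset Strict Implicit.
Import Order.TTheory GRing.Theory Num.Theory numFieldNormedType.Exports.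
Local Open Scope classical_set_scope.
Local Open Scope ring_scope.
Variables (R : realType) (n m : nat).

(** A derivative along one factor sees only the slice through the base point, so [u] has to be
    identified on that slice alone. *)
Lemma derive_row_mxl (W : normedModType R) (u : 'rV[R]_(n + m) -> W)
    (w : 'rV[R]_n -> W) (a v : 'rV[R]_n) (b : 'rV[R]_m) :
  (forall x, u (row_mx x b) = w x) -> 'D_(row_mx v 0) u (row_mx a b) = 'D_v w a.
Proof.
move=> uw; apply: derive_line => s.
by rewrite scale_row_mx scaler0 add_row_mx add0r uw.
Qed.

Lemma derive_row_mxr (W : normedModType R) (u : 'rV[R]_(n + m) -> W)
    (w : 'rV[R]_m -> W) (a : 'rV[R]_n) (b v : 'rV[R]_m) :
  (forall y, u (row_mx a y) = w y) -> 'D_(row_mx 0 v) u (row_mx a b) = 'D_v w b.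
Proof.
move=> uw; apply: derive_line => s.
by rewrite scale_row_mx scaler0 add_row_mx add0r uw.
Qed.

Lemma mul_row_block_diag (u w : 'rV[R]_n) (u' w' : 'rV[R]_m) A B :
  (row_mx u u' *m block_mx A 0 0 B *m (row_mx w w')^T) 0 0 =
  (u *m A *m w^T) 0 0 + (u' *m B *m w'^T) 0 0.
Proof.
by rewrite tr_row_mx mul_row_block !mulmx0 addr0 add0r mul_row_col mxE.
Qed.

Variables (M : premanifold R n) (F : premanifold R m).
Local Notation P := (product_manifold M F).

Lemma coord_change_prod (i j : chart_ix M) (i' j' : chart_ix F) p q :
  @coord_change R _ P (i, i') (j, j') (p, q) =
  block_mx (coord_change i j p) 0 0 (coord_change i' j' q).
Proof.
apply/matrixP => k l; rewrite -[k]splitK -[l]splitK.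
case: (fintype.split k) => {}k; case: (fintype.split l) => {}l /=.
- rewrite block_mxEul [LHS]mxE [RHS]mxE delta_mx_lshift.
  by apply: derive_row_mxl => x; rewrite /= row_mxEl row_mxKl.
- rewrite block_mxEur [LHS]mxE [RHS]mxE delta_mx_lshift.
  rewrite (@derive_row_mxl _ _ (cst (chart j' (chart_inv i' (chart i' q)) 0 l))).
    by rewrite derive_cst.
  by move=> x; rewrite /= row_mxEr row_mxKr.
- rewrite block_mxEdl [LHS]mxE [RHS]mxE delta_mx_rshift.
  rewrite (@derive_row_mxr _ _ (cst (chart j (chart_inv i (chart i p)) 0 l))).
    by rewrite derive_cst.
  by move=> x; rewrite /= row_mxEl row_mxKl.
- rewrite block_mxEdr [LHS]mxE [RHS]mxE delta_mx_rshift.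
  by apply: derive_row_mxr => x; rewrite /= row_mxEr row_mxKr.
Qed.

Lemma fields_in_prod r (A : P -> 'M[R]_(r, n)) (B : P -> 'M[R]_(r, m))
    (i : chart_ix M) (i' : chart_ix F) x y :
  let p := (chart_inv i x, chart_inv i' y) in
  @fields_in R _ P r (i, i') (fun p => row_mx (A p) (B p)) (row_mx x y) =
  row_mx (A p *m coord_change (chart_at p.1) i p.1)
         (B p *m coord_change (chart_at p.2) i' p.2).
Proof.
rewrite /= /fields_in /= row_mxKl row_mxKr coord_change_prod mul_row_block.
by rewrite !mulmx0 addr0 add0r.
Qed.

Variables (g : bilin M) (h : bilin F) (f : M -> R).
Local Notation gbar := (warped_metric f g h).
Local Notation warp p := (expR (- (2 * f p / m%:R))).

Lemma metric_in_warped (i : chart_ix M) (i' : chart_ix F) x y :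
  @metric_in R _ P gbar (i, i') (row_mx x y) =
  block_mx (metric_in g i x) 0
           0 (warp (chart_inv i x) *: metric_in h i' y).
Proof.
rewrite /metric_in /= row_mxKl row_mxKr coord_change_prod /warped_metric /=.
rewrite tr_block_mx !trmx0 !mulmx_block !mulmx0 !mul0mx !addr0 !add0r.
by rewrite !mul0mx -scalemxAr -scalemxAl.
Qed.

Lemma inner_warped p q x v y w :
  @inner R _ P gbar (p, q) (row_mx x v) (row_mx y w) =
  inner g p x y + warp p * inner h q v w.
Proof. by rewrite /inner mul_row_block_diag -scalemxAr -scalemxAl [X in _ + X]mxE. Qed.

Hypotheses (Mm : is_manifold M) (Fm : is_manifold F).
Hypotheses (gm : is_metric g) (hm : is_metric h) (fs : smooth_fun setT f).

(** The constant [k] is left free: it is -2/m for the metric and 1/m for the frame. *)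
Lemma derive_warp k (p : M) v :
  'D_v (fun x => expR (k * f (chart_inv (chart_at p) x))) (chart (chart_at p) p) =
  k * expR (k * f p) * dir_deriv f p v.
Proof.
by rewrite derive_expRM ?chart_atK//; exact: (smooth_fun_differentiable Mm fs).
Qed.

Let warpE p : warp p = expR (- (2 / m%:R) * f p).
Proof. by congr expR; rewrite mulNr; congr (- _); rewrite mulrAC. Qed.

Lemma partial_metric_warpedl p q (a : 'I_n) :
  @partial_metric R _ P gbar (p, q) (lshift m a) =
  block_mx (partial_metric g p a) 0
    0 ((- (2 / m%:R) * warp p * dir_deriv f p (delta_mx 0 a)) *: h q).
Proof.
apply/matrixP => k l; rewrite [LHS]mxE delta_mx_lshift -[k]splitK -[l]splitK /=.
case: (fintype.split k) => {}k; case: (fintype.split l) => {}l /=.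
- rewrite block_mxEul [RHS]mxE; apply: derive_row_mxl => x.
  by rewrite metric_in_warped block_mxEul.
- rewrite block_mxEur [RHS]mxE (@derive_row_mxl _ _ (cst 0)) ?derive_cst// => x.
  by rewrite metric_in_warped block_mxEur mxE.
- rewrite block_mxEdl [RHS]mxE (@derive_row_mxl _ _ (cst 0)) ?derive_cst// => x.
  by rewrite metric_in_warped block_mxEdl mxE.
- rewrite block_mxEdr [RHS]mxE (@derive_row_mxl _ _ (fun x =>
    expR (- (2 / m%:R) * f (chart_inv (chart_at p) x)) * h q k l)); last first.
    by move=> x; rewrite metric_in_warped block_mxEdr mxE metric_in_at// warpE.
  rewrite derive_mulr ?derive_warp -?warpE//.
  exact: differentiable_expRM (smooth_fun_differentiable Mm fs _).
Qed.

Lemma partial_metric_warpedr p q (b : 'I_m) :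
  @partial_metric R _ P gbar (p, q) (rshift n b) =
  block_mx 0 0 0 (warp p *: partial_metric h q b).
Proof.
apply/matrixP => k l; rewrite [LHS]mxE delta_mx_rshift -[k]splitK -[l]splitK /=.
case: (fintype.split k) => {}k; case: (fintype.split l) => {}l /=.
- rewrite block_mxEul [RHS]mxE (@derive_row_mxr _ _ (cst (g p k l))).
    by rewrite derive_cst.
  by move=> y; rewrite metric_in_warped block_mxEul metric_in_at.
- rewrite block_mxEur [RHS]mxE (@derive_row_mxr _ _ (cst 0)) ?derive_cst// => y.
  by rewrite metric_in_warped block_mxEur mxE.
- rewrite block_mxEdl [RHS]mxE (@derive_row_mxr _ _ (cst 0)) ?derive_cst// => y.
  by rewrite metric_in_warped block_mxEdl mxE.
- rewrite block_mxEdr [RHS]mxE [X in _ * X]mxE (@derive_row_mxr _ _ (fun y =>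
    metric_in h (chart_at q) y k l * warp p)); last first.
    by move=> y; rewrite metric_in_warped block_mxEdr mxE chart_atK// mulrC.
  rewrite derive_mulr 1?mulrC//; have [_ _ hs] := hm.
  apply: (smooth_on_differentiable (hs _ _ _)).
  by exists q => //; case: Fm => _ dom _ _ _; exact: dom.
Qed.

(** The product rule on the fibre block: horizontal directions differentiate the warping factor,
    with logarithmic derivative -2/m df, and vertical ones differentiate [h]. *)
Lemma metric_deriv_warped (p : M) (q : F) x v :
  @metric_deriv R _ P gbar (p, q) (row_mx x v) =
  block_mx (metric_deriv g p x) 0 0
   ((- (2 / m%:R) * warp p * dir_deriv f p x) *: h q
     + warp p *: metric_deriv h q v).
Proof.
rewrite /metric_deriv big_split_ord /=.
under eq_bigr do rewrite row_mxEl partial_metric_warpedl scale_block_mx !scaler0.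
under [X in _ + X]eq_bigr do
  rewrite row_mxEr partial_metric_warpedr scale_block_mx !scaler0.
have sumB (I : finType) (A : I -> 'M[R]_n) (B : I -> 'M[R]_m) :
    \sum_i block_mx (A i) 0 0 (B i) = block_mx (\sum_i A i) 0 0 (\sum_i B i).
  elim: (index_enum I) => [|i s IH]; first by rewrite !big_nil block_mx0.
  by rewrite !big_cons IH add_block_mx !addr0.
rewrite !sumB add_block_mx !addr0; congr (block_mx _ _ _ (_ + _)).
  by rewrite big1_eq addr0.
  rewrite /dir_deriv derive_sumE; last exact: (smooth_fun_differentiable Mm fs).
  by rewrite mulr_sumr scaler_suml; apply: eq_bigr => a _; rewrite scalerA mulrCA.
by rewrite scaler_sumr; apply: eq_bigr => b _; rewrite !scalerA mulrC.
Qed.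

(** The 1/2 of the Koszul formula meets the factor -2/m from the warping, which leaves -1/m in front
    of the three terms in df. *)
Lemma koszul_warped (p : M) (q : F) x v y y' z z' :
  @koszul R _ P gbar (p, q) (row_mx x v) (row_mx y y') (row_mx z z') =
  koszul g p x y z + warp p * koszul h q v y' z'
  - warp p / m%:R * (dir_deriv f p x * inner h q y' z'
                     + dir_deriv f p y * inner h q v z'
                     - dir_deriv f p z * inner h q v y').
Proof.
have bil (u w : 'rV[R]_m) (c d : R) (A B : 'M[R]_m) :
    (u *m (c *: A + d *: B) *m w^T) 0 0 =
    c * (u *m A *m w^T) 0 0 + d * (u *m B *m w^T) 0 0.
  by rewrite mulmxDr mulmxDl -!scalemxAr -!scalemxAl !mxE.
rewrite /koszul !metric_deriv_warped !mul_row_block_diag !bil /inner.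
(* With the inverse of m abstracted, 2 is the only denominator left for [field]. *)
by move: (warp p) (m%:R^-1 : R) => w c; field.
Qed.

End WarpedGeometry.

(** * Orthonormal frames and their connection coefficients *)

Section SpinFrames.
Set Implicit Arguments.
Unset Strict Implicit.
Import Order.TTheory GRing.Theory Num.Theory numFieldNormedType.Exports.
Local Open Scope classical_set_scope.
Local Open Scope complex_scope.
Local Open Scope ring_scope.
Variables (R : realType) (n : nat) (M : premanifold R n) (g : bilin M).
Variable S : prespin M.

Lemma inner_rows r (A : 'M[R]_(r, n)) (p : M) k l :
  inner g p (row k A) (row l A) = (A *m g p *m A^T) k l.
Proof.
rewrite /inner -row_mul mxE [RHS]mxE; apply: eq_bigr => j _.
by rewrite tr_row [LHS]mulrC [RHS]mulrC; congr (_ * _); rewrite mxE.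
Qed.

Lemma cliff_mul_frame (a : spin_ix S) (p : M) k z :
  spin_frame a p *m g p *m (spin_frame a p)^T = 1%:M ->
  cliff_mul g a p (row k (spin_frame a p)) z = spin_gamma S k *m z.
Proof.
move=> on; rewrite /cliff_mul; congr (_ *m _).
rewrite /cliff (bigD1 k)//= big1 ?addr0 => [|l lk].
  by rewrite mxE inner_rows on mxE eqxx scale1r.
by rewrite mxE inner_rows on mxE eq_sym (negPf lk) scale0r.
Qed.

(** Clifford multiplication by a frame vector is the matching generator. Orthonormality is asked at
    [p] alone, so that [warped_frame_orthonormal] provides it on the product. *)
Lemma dirac_opE (psi : prespinor S) (a : spin_ix S) (p : M) :
  spin_frame a p *m g p *m (spin_frame a p)^T = 1%:M ->
  dirac_op g psi a p = \sum_k spin_gamma S k *m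
    spin_connection g psi a p (row k (spin_frame a p)).
Proof. by move=> on; apply: eq_bigr => k _; rewrite cliff_mul_frame. Qed.

Lemma spin_frame_orthonormal (a : spin_ix S) (p : M) :
  is_spin_structure g S -> spin_dom a p ->
  spin_frame a p *m g p *m (spin_frame a p)^T = 1%:M.
Proof. by move=> [_ [[_ _ on _] _]] ap; have [] := on a a p ap ap. Qed.

(** The matrix of connection 1-forms of the frame, evaluated on [v]; it is the coefficient that
    appears in [spin_connection]. *)
Definition frame_conn (a : spin_ix S) (p : M) (v : 'rV[R]_n) (k l : 'I_n) : R :=
  inner g p (levi_civita g (fun q => row k (spin_frame a q)) p v)
            (row l (spin_frame a p)).

(** It removes the rescaling of the vertical frame; with a factor zero it gives [koszul0m] and
    [koszul0r]. *)
Lemma koszulZ (p : M) (v Y Z : 'rV[R]_n) (c d : R) :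
  koszul g p v (c *: Y) (d *: Z) = c * d * koszul g p v Y Z.
Proof.
have mdZ (k : R) w : metric_deriv g p (k *: w) = k *: metric_deriv g p w.
  rewrite /metric_deriv scaler_sumr; apply: eq_bigr => a _.
  by rewrite mxE scalerA.
have bilZl (k : R) (u w : 'rV[R]_n) (A : 'M[R]_n) :
    ((k *: u) *m A *m w^T) 0 0 = k * (u *m A *m w^T) 0 0.
  by rewrite -!scalemxAl mxE.
have bilZr (k : R) (u w : 'rV[R]_n) (A : 'M[R]_n) :
    (u *m A *m (k *: w)^T) 0 0 = k * (u *m A *m w^T) 0 0.
  by rewrite linearZ /= -scalemxAr mxE.
have bilZm (k : R) (u w : 'rV[R]_n) (A : 'M[R]_n) :
    (u *m (k *: A) *m w^T) 0 0 = k * (u *m A *m w^T) 0 0.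
  by rewrite -scalemxAr -scalemxAl mxE.
by rewrite /koszul !mdZ !bilZm !bilZl !bilZr; ring.
Qed.

Lemma inner0l (p : M) v : inner g p 0 v = 0.
Proof. by rewrite /inner !mul0mx mxE. Qed.

Lemma inner0r (p : M) v : inner g p v 0 = 0.
Proof. by rewrite /inner trmx0 mulmx0 mxE. Qed.

Lemma innerZl (p : M) c v w : inner g p (c *: v) w = c * inner g p v w.
Proof. by rewrite /inner -!scalemxAl mxE. Qed.

Lemma innerZr (p : M) c v w : inner g p v (c *: w) = c * inner g p v w.
Proof. by rewrite /inner linearZ /= -scalemxAr mxE. Qed.

Lemma metric_deriv0 (p : M) : metric_deriv g p 0 = 0.
Proof. by rewrite /metric_deriv big1 // => k _; rewrite mxE scale0r. Qed.

Lemma koszul0l (p : M) Y Z : koszul g p 0 Y Z = 0.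
Proof.
by rewrite /koszul metric_deriv0 !(mul0mx, mulmx0) !mxE subr0 addr0 mulr0.
Qed.

Lemma koszul0m (p : M) v Z : koszul g p v 0 Z = 0.
Proof. by rewrite -(scale0r 0) -[Z]scale1r koszulZ !mul0r. Qed.

Lemma koszul0r (p : M) v Y : koszul g p v Y 0 = 0.
Proof. by rewrite -(scale0r 0) -[Y]scale1r koszulZ mulr0 mul0r. Qed.

End SpinFrames.

(** * The frame of the warped product and its connection coefficients *)

Section WarpedSpin.
Set Implicit Arguments.
Unset Strict Implicit.
Import Order.TTheory GRing.Theory Num.Theory numFieldNormedType.Exports.
Local Open Scope classical_set_scope.
Local Open Scope complex_scope.
Local Open Scope ring_scope.
Variables (R : realType) (n m : nat).

(** Horizontal indices precede vertical ones, so a mixed pair always has its horizontal index first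
    and is never excluded by [k < l]. *)
Lemma big_ord_lt_split (V : nmodType) (E : 'I_(n + m) -> 'I_(n + m) -> V) :
  \sum_(k < n + m) \sum_(l < n + m | (k < l)%N) E k l =
  \sum_(k < n) \sum_(l < n | (k < l)%N) E (lshift m k) (lshift m l)
  + \sum_(k < n) \sum_(l < m) E (lshift m k) (rshift n l)
  + \sum_(k < m) \sum_(l < m | (k < l)%N) E (rshift n k) (rshift n l).
Proof.
rewrite big_split_ord /=; congr (_ + _).
  rewrite -big_split /=; apply: eq_bigr => k _.
  rewrite big_mkcond big_split_ord /= -big_mkcond; congr (_ + _).
  by apply: eq_bigr => l _; rewrite ltn_addr.
apply: eq_bigr => k _.
rewrite big_mkcond big_split_ord /= big1 ?add0r => [|l _]; last first.
  by rewrite ltnNge (leq_trans (ltnW (ltn_ord l)) (leq_addr _ _)).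
by rewrite [RHS]big_mkcond; apply: eq_bigr => l _; rewrite ltn_add2l.
Qed.

Lemma product_gammal N N' (gam : 'I_n -> 'M[R[i]]_N) (gam' : 'I_m -> 'M[R[i]]_N') k :
  product_gamma gam gam' (lshift m k) = tensmx (gam k) 1%:M.
Proof. by rewrite /product_gamma (unsplitK (inl k)). Qed.

Lemma product_gammar N N' (gam : 'I_n -> 'M[R[i]]_N) (gam' : 'I_m -> 'M[R[i]]_N') k :
  product_gamma gam gam' (rshift n k) = tensmx (omega gam) (gam' k).
Proof. by rewrite /product_gamma (unsplitK (inr k)). Qed.

Variables (M : premanifold R n) (F : premanifold R m).
Local Notation P := (product_manifold M F).
Hypotheses (Mm : is_manifold M) (Fm : is_manifold F).

Lemma field_deriv_horizontal (Y : M -> 'rV[R]_n) (p : M) (q : F) :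
  let Ybar : P -> 'rV[R]_(n + m) := fun pq => row_mx (Y pq.1) 0 in
  (forall x, field_deriv Ybar (p, q) (row_mx x 0) = row_mx (field_deriv Y p x) 0) /\
  (forall v, field_deriv Ybar (p, q) (row_mx 0 v) = 0).
Proof.
move=> Ybar.
have YE x y : @fields_in R _ P 1 (chart_at p, chart_at q) Ybar (row_mx x y) =
    row_mx (fields_in (chart_at p) Y x) 0.
  by rewrite (fields_in_prod (fun pq => Y pq.1) (fun=> 0)) mul0mx.
split=> [x|v]; apply/rowP => k; rewrite [LHS]mxE -[k]splitK /=;
  case: (fintype.split k) => {}k /=.
- by rewrite row_mxEl [RHS]mxE; apply: derive_row_mxl => y; rewrite YE row_mxEl.
- rewrite row_mxEr [RHS]mxE (@derive_row_mxl _ _ _ _ _ (cst 0)) ?derive_cst// => y.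
  by rewrite YE row_mxEr mxE.
- rewrite [RHS]mxE (@derive_row_mxr _ _ _ _ _ (cst (Y p 0 k))) ?derive_cst// => y.
  by rewrite YE row_mxEl fields_in_at.
- rewrite [RHS]mxE (@derive_row_mxr _ _ _ _ _ (cst 0)) ?derive_cst// => y.
  by rewrite YE row_mxEr mxE.
Qed.

Variables (g : bilin M) (h : bilin F) (f : M -> R).
Hypotheses (gm : is_metric g) (hm : is_metric h) (fs : smooth_fun setT f).
Local Notation gbar := (warped_metric f g h).
Local Notation warp p := (expR (- (2 * f p / m%:R))).
Local Notation scale p := (expR (f p / m%:R)).

(** The factor exp(f/m) varies only along M, where it contributes df/m; along F it is a constant
    that comes out of the derivative. *)
Lemma field_deriv_vertical (Y : F -> 'rV[R]_m) (p : M) (q : F) :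
  (forall k, differentiable (fun y => fields_in (chart_at q) Y y 0 k)
                            (chart (chart_at q) q)) ->
  let Ybar : P -> 'rV[R]_(n + m) := fun pq => row_mx 0 (scale pq.1 *: Y pq.2) in
  (forall x, field_deriv Ybar (p, q) (row_mx x 0) =
             row_mx 0 ((m%:R^-1 * scale p * dir_deriv f p x) *: Y q)) /\
  (forall v, field_deriv Ybar (p, q) (row_mx 0 v) =
             row_mx 0 (scale p *: field_deriv Y q v)).
Proof.
move=> dY Ybar.
have YE x y : @fields_in R _ P 1 (chart_at p, chart_at q) Ybar (row_mx x y) =
    row_mx 0 (scale (chart_inv (chart_at p) x) *: fields_in (chart_at q) Y y).
  rewrite (fields_in_prod (fun=> 0) (fun pq : P => scale pq.1 *: Y pq.2)) mul0mx.
  by rewrite -scalemxAl.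
split=> [x|v]; apply/rowP => k; rewrite [LHS]mxE -[k]splitK /=;
  case: (fintype.split k) => {}k /=.
- rewrite row_mxEl [RHS]mxE (@derive_row_mxl _ _ _ _ _ (cst 0)) ?derive_cst// => y.
  by rewrite YE row_mxEl mxE.
- rewrite row_mxEr [RHS]mxE (@derive_row_mxl _ _ _ _ _ (fun y =>
    expR (m%:R^-1 * f (chart_inv (chart_at p) y)) * Y q 0 k)); last first.
    by move=> y; rewrite YE row_mxEr mxE fields_in_at// [f _ / _]mulrC.
  rewrite derive_mulr; last first.
    exact: differentiable_expRM (smooth_fun_differentiable Mm fs _).
  by rewrite derive_warp// [f p / _]mulrC.
- rewrite row_mxEl [RHS]mxE (@derive_row_mxr _ _ _ _ _ (cst 0)) ?derive_cst// => y.
  by rewrite YE row_mxEl mxE.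
- rewrite row_mxEr [RHS]mxE [X in _ = _ * X]mxE (@derive_row_mxr _ _ _ _ _ (fun y =>
    fields_in (chart_at q) Y y 0 k * scale p)); last first.
    by move=> y; rewrite YE row_mxEr mxE chart_atK// mulrC.
  by rewrite derive_mulr// mulrC.
Qed.

Variables (SM : prespin M) (SF : prespin F).
Hypotheses (SMs : is_spin_structure g SM) (SFs : is_spin_structure h SF).
Variables (a : spin_ix SM) (b : spin_ix SF) (p : M) (q : F).
Hypotheses (ap : spin_dom a p) (bq : spin_dom b q).
Local Notation Sbar := (warped_spin f SM SF).
Local Notation Ebar := (@spin_frame _ _ _ Sbar (a, b)).

Lemma row_warped_framel k (pq : P) :
  row (lshift m k) (Ebar pq) = row_mx (row k (spin_frame a pq.1)) 0.
Proof.
rewrite /= /block_mx; apply/rowP => j; rewrite [LHS]mxE col_mxEu.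
by rewrite !mxE; case: fintype.splitP => ? ?; rewrite !mxE.
Qed.

Lemma row_warped_framer k (pq : P) :
  row (rshift n k) (Ebar pq) = row_mx 0 (scale pq.1 *: row k (spin_frame b pq.2)).
Proof.
rewrite /= /block_mx; apply/rowP => j; rewrite [LHS]mxE col_mxEd.
by rewrite !mxE; case: fintype.splitP => ? ?; rewrite !mxE.
Qed.

(** The vertical frame is stretched by exactly the factor that keeps it orthonormal for the warped
    metric. *)
Lemma warp_scale : warp p * scale p * scale p = 1.
Proof.
rewrite -mulrA -!expRD -[RHS]expR0; congr expR.
by rewrite -mulrA mulr_natl mulr2n addNr.
Qed.

Lemma warped_frame_orthonormal : Ebar (p, q) *m gbar (p, q) *m (Ebar (p, q))^T = 1%:M.
Proof.
rewrite /= /warped_metric /= tr_block_mx !trmx0 !mulmx_block.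
rewrite !mulmx0 !mul0mx !addr0 !add0r !mul0mx (spin_frame_orthonormal SMs)//.
rewrite -!scalemxAr -!scalemxAl [(_ *: _)^T]linearZ -scalemxAr.
rewrite (spin_frame_orthonormal SFs)// !scalerA.
by rewrite warp_scale scale1r -scalar_mx_block.
Qed.

Lemma inner_levi_civita_warped (Y : P -> 'rV[R]_(n + m)) v Z :
  @inner R _ P gbar (p, q) (levi_civita gbar Y (p, q) v) Z =
  @inner R _ P gbar (p, q) (field_deriv Y (p, q) v) Z
  + @koszul R _ P gbar (p, q) v (Y (p, q)) Z.
Proof.
have [[gsym _ _] [hsym _ _]] := (gm, hm).
apply: inner_levi_civita; rewrite /= ?metric_in_warped /= /warped_metric /=.
- by rewrite !metric_in_at// chart_atK.
- by rewrite tr_block_mx !trmx0 linearZ /= gsym hsym.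
- by rewrite block_diag_mx_unit unitmxZ ?unitfE ?gt_eqF ?expR_gt0// !metric_unitmx.
Qed.

Lemma frame_connE (N : nat) (X : premanifold R N) (k : bilin X) (S : prespin X)
    (c : spin_ix S) (x : X) v i j : is_manifold X -> is_metric k ->
  frame_conn k c x v i j =
  inner k x (field_deriv (fun y => row i (spin_frame c y)) x v) (row j (spin_frame c x))
  + koszul k x v (row i (spin_frame c x)) (row j (spin_frame c x)).
Proof.
move=> Xm km; have [ksym _ _] := km.
by apply: inner_levi_civita; rewrite ?metric_in_at ?metric_unitmx.
Qed.

Lemma frame_differentiable k l :
  differentiable (fun y => fields_in (chart_at q) (fun z => row k (spin_frame b z)) y 0 l)
                 (chart (chart_at q) q).
Proof.
have [_ [[_ _ _ smo] _]] := SFs.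
have -> : (fun y => fields_in (chart_at q) (fun z => row k (spin_frame b z)) y 0 l) =
    (fun y => fields_in (chart_at q) (spin_frame b) y k l).
  by apply/funext => y; rewrite /fields_in -row_mul mxE.
apply: (smooth_on_differentiable (smo _ _ _ _)).
by exists q => //; split=> //; case: Fm => _ dom _ _ _; exact: dom.
Qed.

Let conn := @frame_conn R _ P gbar Sbar (a, b) (p, q).

Let connE v i j : conn v i j =
  @inner R _ P gbar (p, q) (field_deriv (fun y => row i (Ebar y)) (p, q) v)
                           (row j (Ebar (p, q)))
  + @koszul R _ P gbar (p, q) v (row i (Ebar (p, q))) (row j (Ebar (p, q))).
Proof. exact: inner_levi_civita_warped. Qed.

Let horizE k : (fun y : P => row (lshift m k) (Ebar y)) =
  fun y => row_mx (row k (spin_frame a y.1)) 0.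
Proof. by apply/funext => y; exact: row_warped_framel. Qed.

Let vertE k : (fun y : P => row (rshift n k) (Ebar y)) =
  fun y => row_mx 0 (scale y.1 *: row k (spin_frame b y.2)).
Proof. by apply/funext => y; exact: row_warped_framer. Qed.

Let dir_deriv0 : dir_deriv f p 0 = 0.
Proof. by rewrite -(inner_gradient _ _ Mm gm fs) inner0r. Qed.

(** Each lifted frame vector has a vanishing component, so these rules remove most terms of
    [inner_warped] and [koszul_warped]. *)
Let zeros := (mulr0, mul0r, addr0, add0r, oppr0, subr0, inner0l, inner0r,
  koszul0l, koszul0m, koszul0r,
  dir_deriv0).

Lemma conn_horizontal x :
  [/\ forall k l, conn (row_mx x 0) (lshift m k) (lshift m l) = frame_conn g a p x k l,
      forall k l, conn (row_mx x 0) (lshift m k) (rshift n l) = 0 &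
      forall k l, conn (row_mx x 0) (rshift n k) (rshift n l) = 0].
Proof.
split=> k l; rewrite connE ?horizE ?vertE !(row_warped_framel, row_warped_framer) /=.
- have [-> _] := field_deriv_horizontal (fun y => row k (spin_frame a y)) p q.
  by rewrite koszul_warped// inner_warped !zeros frame_connE.
- have [-> _] := field_deriv_horizontal (fun y => row k (spin_frame a y)) p q.
  by rewrite koszul_warped// inner_warped !zeros.
(* The derivative of the factor exp(f/m) of the frame cancels the term in df(x) of the Koszul
   formula. *)
- have [-> _] := field_deriv_vertical p (frame_differentiable k).
  rewrite koszul_warped// inner_warped !zeros.
  rewrite !innerZl !innerZr.
  have := warp_scale.
  move: (warp p) (scale p) => w c wc; ring: wc.
Qed.

(** Up to sign the mixed coefficients are the second fundamental form of the fibres, which are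
    totally umbilic: they are proportional to h(v, e'_l). *)
Lemma conn_vertical v :
  [/\ forall k l, conn (row_mx 0 v) (lshift m k) (lshift m l) = 0,
      forall k l, conn (row_mx 0 v) (lshift m k) (rshift n l) =
        - (warp p * scale p / m%:R * dir_deriv f p (row k (spin_frame a p))
           * inner h q v (row l (spin_frame b q))) &
      forall k l, conn (row_mx 0 v) (rshift n k) (rshift n l) = frame_conn h b q v k l].
Proof.
split=> k l; rewrite connE ?horizE ?vertE !(row_warped_framel, row_warped_framer) /=.
- have [_ ->] := field_deriv_horizontal (fun y => row k (spin_frame a y)) p q.
  by rewrite koszul_warped// !zeros.
- have [_ ->] := field_deriv_horizontal (fun y => row k (spin_frame a y)) p q.
  by rewrite koszul_warped// !zeros innerZr; ring.
- have [_ ->] := field_deriv_vertical p (frame_differentiable k).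
  rewrite koszul_warped// inner_warped koszulZ !zeros.
  rewrite innerZl innerZr frame_connE//.
  have := warp_scale.
  move: (warp p) (scale p) => w c wc.
  move: (inner h q _ _) (koszul h q v _ _) => A B; ring: wc.
Qed.

(** * Spin connection and Dirac operator on tensor products of spinors *)

Variables (phi : prespinor SM) (nu : prespinor SF).
Hypotheses (phis : is_spinor phi) (nus : is_spinor nu).
Local Notation psi := (tensor_spinor f phi nu).

Lemma spinor_dir_deriv_horizontal x :
  @spinor_dir_deriv _ _ _ Sbar (psi (a, b)) (p, q) (row_mx x 0) =
  tensmx (spinor_dir_deriv (phi a) p x) (nu b q).
Proof.
have [_ sphi] := phis.
apply/matrixP => r j; rewrite ord1 [LHS]mxE [RHS]mxE !ord1.
set r1 := (mxtens_unindex r).1; set r2 := (mxtens_unindex r).2.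
have [/(smooth_fun_differentiable Mm)/(_ ap) dRe
      /(smooth_fun_differentiable Mm)/(_ ap) dIm] := sphi a r1.
pose z := nu b q r2 0.
have psiE y : psi (a, b) (chart_inv (chart_at p) y, q) r 0 =
    phi a (chart_inv (chart_at p) y) r1 0 * z.
  by rewrite mxE !ord1.
(* Derivatives of spinors are taken on real and imaginary parts, so multiplication by the constant
   [z] is split into the form handled by [derive_mulrD]. *)
have ReM (u w : R[i]) :
  complex.Re (u * w) = complex.Re u * complex.Re w + complex.Im u * (- complex.Im w).
  by case: u w => [? ?] [? ?] /=; rewrite mulrN.
have ImM (u w : R[i]) :
  complex.Im (u * w) = complex.Re u * complex.Im w + complex.Im u * complex.Re w.
  by case: u w => [? ?] [? ?].
rewrite /dir_deriv /=.
rewrite (@derive_row_mxl _ _ _ _ _ (fun y =>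
  complex.Re (phi a (chart_inv (chart_at p) y) r1 0) * complex.Re z
  + complex.Im (phi a (chart_inv (chart_at p) y) r1 0) * (- complex.Im z))); last first.
  by move=> y; rewrite /= row_mxKl row_mxKr chart_atK// psiE ReM.
rewrite (@derive_row_mxl _ _ _ _ _ (fun y =>
  complex.Re (phi a (chart_inv (chart_at p) y) r1 0) * complex.Im z
  + complex.Im (phi a (chart_inv (chart_at p) y) r1 0) * complex.Re z)); last first.
  by move=> y; rewrite /= row_mxKl row_mxKr chart_atK// psiE ImM.
rewrite !derive_mulrD// [spinor_dir_deriv _ _ _ _ _]mxE -/z.
by case: z {psiE} => c d; congr (_ +i* _); rewrite mulrN.
Qed.

Lemma spinor_dir_deriv_vertical v :
  @spinor_dir_deriv _ _ _ Sbar (psi (a, b)) (p, q) (row_mx 0 v) =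
  tensmx (phi a p) (spinor_dir_deriv (nu b) q v).
Proof.
have [_ snu] := nus.
apply/matrixP => r j; rewrite ord1 [LHS]mxE [RHS]mxE !ord1.
set r1 := (mxtens_unindex r).1; set r2 := (mxtens_unindex r).2.
have [/(smooth_fun_differentiable Fm)/(_ bq) dRe
      /(smooth_fun_differentiable Fm)/(_ bq) dIm] := snu b r2.
pose z := phi a p r1 0.
have psiE y : psi (a, b) (p, chart_inv (chart_at q) y) r 0 =
    z * nu b (chart_inv (chart_at q) y) r2 0.
  by rewrite mxE !ord1.
have ReM (u w : R[i]) :
  complex.Re (w * u) = complex.Re u * complex.Re w + complex.Im u * (- complex.Im w).
  by case: u w => [? ?] [? ?] /=; ring.
have ImM (u w : R[i]) :
  complex.Im (w * u) = complex.Re u * complex.Im w + complex.Im u * complex.Re w.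
  by case: u w => [? ?] [? ?] /=; ring.
rewrite /dir_deriv /=.
rewrite (@derive_row_mxr _ _ _ _ _ (fun y =>
  complex.Re (nu b (chart_inv (chart_at q) y) r2 0) * complex.Re z
  + complex.Im (nu b (chart_inv (chart_at q) y) r2 0) * (- complex.Im z))); last first.
  by move=> y; rewrite /= row_mxKl row_mxKr chart_atK// psiE ReM.
rewrite (@derive_row_mxr _ _ _ _ _ (fun y =>
  complex.Re (nu b (chart_inv (chart_at q) y) r2 0) * complex.Im z
  + complex.Im (nu b (chart_inv (chart_at q) y) r2 0) * complex.Re z)); last first.
  by move=> y; rewrite /= row_mxKl row_mxKr chart_atK// psiE ImM.
rewrite !derive_mulrD// [spinor_dir_deriv _ _ _ _ _]mxE -/z.
case: z {psiE} => c d; congr (_ +i* _).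
  by rewrite mulrN mulrC [_ * d]mulrC.
by rewrite addrC mulrC [_ * d]mulrC.
Qed.

Lemma spin_connection_horizontal x :
  @spin_connection _ _ _ gbar Sbar psi (a, b) (p, q) (row_mx x 0) =
  tensmx (spin_connection g phi a p x) (nu b q).
Proof.
rewrite /spin_connection spinor_dir_deriv_horizontal tensmxDl; congr (_ + _).
rewrite tensmxZl; congr (_ *: _); rewrite big_ord_lt_split.
have [cll clr crr] := conn_horizontal x.
rewrite [X in _ + X]big1 ?addr0 => [|k _]; last first.
  by rewrite big1 // => l _; rewrite [inner _ _ _ _]crr scale0r.
rewrite [X in _ + X]big1 ?addr0 => [|k _]; last first.
  by rewrite big1 // => l _; rewrite [inner _ _ _ _]clr scale0r.
rewrite tensmx_suml; apply: eq_bigr => k _.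
rewrite tensmx_suml; apply: eq_bigr => l _.
rewrite [inner _ _ _ _]cll tensmxZl /= !product_gammal tensmx_mul mulmx1.
by rewrite tensmx_mul_col mul1mx.
Qed.

(** In a vertical pair the two factors [omega] multiply to 1, which leaves the spin connection of F;
    in a mixed pair one [omega] remains and gives the sum over k and l. *)
Lemma spin_connection_vertical v : ~~ odd n ->
  @spin_connection _ _ _ gbar Sbar psi (a, b) (p, q) (row_mx 0 v) =
  tensmx (phi a p) (spin_connection h nu b q v)
  - 2^-1 *: \sum_k \sum_l (warp p * scale p / m%:R
        * dir_deriv f p (row k (spin_frame a p))
        * inner h q v (row l (spin_frame b q)))%:C
     *: tensmx (spin_gamma SM k *m omega (@spin_gamma _ _ _ SM) *m phi a p)
               (spin_gamma SF l *m nu b q).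
Proof.
move=> n_even; have [SMmod _] := SMs.
rewrite /spin_connection spinor_dir_deriv_vertical tensmxDr -addrA; congr (_ + _).
rewrite tensmxZr -scalerBr; congr (_ *: _); rewrite big_ord_lt_split.
have [cll clr crr] := conn_vertical v.
rewrite [X in X + _ + _]big1 ?add0r => [|k _]; last first.
  by rewrite big1 // => l _; rewrite [inner _ _ _ _]cll scale0r.
rewrite addrC; congr (_ + _).
  rewrite tensmx_sumr; apply: eq_bigr => k _.
  rewrite tensmx_sumr; apply: eq_bigr => l _.
  rewrite [inner _ _ _ _]crr tensmxZr /= !product_gammar tensmx_mul omega_sqr//.
  by rewrite tensmx_mul_col mul1mx.
rewrite -sumrN; apply: eq_bigr => k _; rewrite -sumrN; apply: eq_bigr => l _.
rewrite [inner _ _ _ _]clr /= product_gammal product_gammar tensmx_mul mul1mx.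
by rewrite tensmx_mul_col raddfN scaleNr.
Qed.

(** The components of the gradient in an orthonormal frame are the df(e_k). *)
Lemma cliff_mul_gradient z :
  cliff_mul g a p (gradient g f p) z =
  \sum_k (dir_deriv f p (row k (spin_frame a p)))%:C *: (spin_gamma SM k *m z).
Proof.
rewrite /cliff_mul /cliff mulmx_suml; apply: eq_bigr => k _.
by rewrite mxE inner_gradient// scalemxAl.
Qed.

Lemma dirac_warped : ~~ odd n -> (0 < m)%N -> parallel h nu ->
  dirac_op gbar psi (a, b) (p, q) =
  tensor_spinor f (weighted_dirac g f phi) nu (a, b) (p, q).
Proof.
move=> n_even m_gt0 nu_par.
have [SMmod _] := SMs; have [SFmod _] := SFs.
rewrite (dirac_opE _ warped_frame_orthonormal) big_split_ord.
rewrite [RHS]/tensor_spinor /weighted_dirac tensmxDl.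
rewrite (dirac_opE _ (spin_frame_orthonormal SMs ap)).
congr (_ + _).
  rewrite tensmx_suml; apply: eq_bigr => k _.
  rewrite row_warped_framel spin_connection_horizontal.
  by rewrite [X in X *m _]product_gammal tensmx_mul_col mul1mx.
pose df k := dir_deriv f p (row k (spin_frame a p)).
(* [T] is the Clifford product of the gradient with [phi], tensored with [nu]; every vertical
   direction contributes the same multiple of it. *)
pose T := \sum_k (df k)%:C *: tensmx (spin_gamma SM k *m phi a p) (nu b q).
transitivity (\sum_(j < m) - (2^-1 * (m%:R^-1)%:C) *: T).
  apply: eq_bigr => j _.
  rewrite row_warped_framer.
  rewrite spin_connection_vertical// nu_par// tensmx0 add0r.
  rewrite mulmxN scaleNr -scalemxAr -scalerA; congr (- (_ *: _)).
  rewrite mulmx_sumr scaler_sumr; apply: eq_bigr => k _.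
  (* The direction is exp(f/m) e'_j, so orthonormality leaves only the term l = j. *)
  rewrite (bigD1 j)//= big1 ?addr0 => [|l lj]; last first.
    rewrite innerZl inner_rows spin_frame_orthonormal// mxE eq_sym (negPf lj).
    by rewrite !mulr0 scale0r.
  rewrite innerZl inner_rows spin_frame_orthonormal// mxE eqxx mulr1.
  (* Two signs cancel here: omega e_k omega = - e_k, and e'_j squares to -1. *)
  rewrite -scalemxAr [X in X *m _]product_gammar tensmx_mul_col !mulmxA gamma_sqr//.
  rewrite -[omega _ *m _ *m omega _]mulmxA gamma_omega// mulmxN mulmxA omega_sqr// mul1mx.
  rewrite !mulNmx mul1mx tensmxNl tensmxNr opprK scalerA -rmorphM /=.
  congr (_%:C *: _).
  (* One exp(f/m) comes from the connection coefficient and one from the direction; together they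
     absorb the warping factor. *)
  have := warp_scale; rewrite -/(df k); move: (warp p) (scale p) => w c wc.
  transitivity (w * c * c * (m%:R^-1 * df k)); first by ring.
  by rewrite wc mul1r.
rewrite sumr_const card_ord cliff_mul_gradient tensmxNl tensmxZl tensmx_suml.
rewrite scaleNr mulNrn -scaler_nat scalerA; congr (- (_ *: _)).
  (* The m equal contributions cancel 1/m, which needs m > 0; the identity is taken in [R] and
     transported to the complex numbers. *)
  rewrite mulrCA -[RHS]mulr1; congr (_ * _).
  rewrite -[m%:R in LHS](rmorph_nat (real_complex R)) -rmorphM mulfV//.
  by rewrite pnatr_eq0 -lt0n.
by apply: eq_bigr => k _; rewrite tensmxZl.
Qed.

End WarpedSpin.

Theorem theorem1p7 (R : realType) (n m : nat)
  (n_even : ~~ odd n) (m_gt0 : (0 < m)%N)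
  (M : premanifold R n) (F : premanifold R m)
  (M_manifold : is_manifold M) (F_manifold : is_manifold F)
  (g : bilin M) (h : bilin F) (g_metric : is_metric g) (h_metric : is_metric h)
  (SM : prespin M) (SF : prespin F)
  (SM_spin : is_spin_structure g SM) (SF_spin : is_spin_structure h SF)
  (f : M -> R) (f_smooth : smooth_fun setT f)
  (phi : prespinor SM) (phi_spinor : is_spinor phi)
  (nu : prespinor SF) (nu_spinor : is_spinor nu) (nu_parallel : parallel h nu)
  (a : spin_ix SM) (b : spin_ix SF) (p : M) (q : F)
  (ap : spin_dom a p) (bq : spin_dom b q) :
  dirac_op (warped_metric f g h) (tensor_spinor f phi nu) (a, b) (p, q) =
  tensor_spinor f (weighted_dirac g f phi) nu (a, b) (p, q).
Proof. exact: dirac_warped. Qed.
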